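(* Let $\mu$ be a symmetric Borel probability measure on $\mathbb{R}$ with cumulative distribution function $F$. Assume that the moment generating function $$L(\delta)=\int_{-\infty}^{+\infty}e^{\delta x}\,d\mu(x)$$ is finite in some neighborhood of $\delta=0$. Let $$h(t)=\sup_{\delta\ge 0}\bigl(\delta t-\ln L(\delta)\bigr)\quad\text{for } t\ge 0.$$ (1) For all integers $1\le k\le n$ and any non-empty family $X$ of $k$-subsets of $\{1,\ldots,n\}$, we have $$k^{-1}\ln|X|\ge h(t)\quad\text{for}\quad t=k^{-1}\Gamma(X,\mu).$$ (2) For any $t>0$ such that $F(t)<1$ and for any $0<\epsilon<0.1$ there exist $k=k(t,\epsilon,\mu)$, $n=n(k)$, and a (non-empty) family $X$ of $k$-subsets of the set $\{1,\ldots,n\}$ such that $$k^{-1}\Gamma(X,\mu)\ge(1-\epsilon)t\quad\text{and}\quad k^{-1}\ln|X|\le h(t)+\epsilon.$$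
   Context: A measure $\mu$ on $\mathbb{R}$ is symmetric if $\mu(A)=\mu(-A)$ for all Borel $A$. $F(t)=\mu((-\infty,t])$. A $k$-subset is a subset with exactly $k$ elements ($k\ge 1$); $|X|$ is the cardinality of $X$. For a non-empty family $X$ of subsets of $\{1,\ldots,n\}$, $$\Gamma(X,\mu)=\mathbf{E}\max_{x\in X}\sum_{i\in x}\gamma_i,$$ where $\gamma_1,\ldots,\gamma_n$ are independent random variables with distribution $\mu$. $L(\delta)$ may equal $+\infty$ for some $\delta$; such $\delta$ contribute $-\infty$ to the supremum defining $h$. *)

(* Defs.v *)
From HB Require Import structures.
From mathcomp Require Import all_boot all_order all_algebra.
From mathcomp Require Import all_classical all_reals all_analysis.
From mathcomp Require Import measurable_realfun.

Set Implicit Arguments.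
Unset Strict Implicit.
Unset Printing Implicit Defensive.

Import Order.TTheory GRing.Theory Num.Theory.
Import numFieldNormedType.Exports.

Local Open Scope classical_set_scope.
Local Open Scope ring_scope.

Definition symmetric_measure (R : realType) (mu : set R -> \bar R) : Prop :=
  forall A : set R, measurable A -> mu A = mu [set - x | x in A].

Definition mgf (R : realType) (mu : probability R R) (delta : R) : \bar R :=
  'M_mu idfun delta.

Lemma mgfE (R : realType) (mu : probability R R) (delta : R) :
  mgf mu delta = (\int[mu]_x (expR (delta * x))%:E)%E.
Proof.
by rewrite /mgf /mmt_gen_fun unlock; apply: eq_integral => x _ /=; rewrite mulrC.
Qed.

(* [lne +oo = +oo], so the [delta] with an infinite [mgf] contribute [-oo];
   the supremum itself may be [+oo]. *)
Definition rate (R : realType) (mu : probability R R) (t : R) : \bar R :=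
  ereal_sup [set ((delta * t)%:E - lne (mgf mu delta))%E |
             delta in [set delta : R | 0 <= delta]].

Definition tcons (R : realType) (n : nat) (p : R * n.-tuple R) : n.+1.-tuple R :=
  [tuple of p.1 :: p.2].

Lemma measurable_tcons (R : realType) n :
  measurable_fun [set: R * n.-tuple R] (@tcons R n).
Proof. exact: measurable_cons. Qed.

HB.instance Definition _ (R : realType) n := isMeasurableFun.Build _ _ _ _
  (@tcons R n) (@measurable_tcons R n).

(* The joint law of [n] independent random variables with distribution [mu];
   see [iid_law_box]. *)
Fixpoint iid_law (R : realType) (mu : probability R R) (n : nat) :
    probability (n.-tuple R) R :=
  match n with
  | 0 => \d_([tuple] : 0.-tuple R)
  | m.+1 => distribution (mu \x iid_law mu m)%E (@tcons R m)
  end.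

(* For a non-empty [X] this supremum over a finite set is a maximum;
   see [max_sumE]. *)
Definition max_sum (R : realType) (n : nat) (X : {set {set 'I_n}})
    (g : 'I_n -> R) : R :=
  sup [set \sum_(i in x) g i | x in [set` X]].

(* The independent variables are realised as the coordinates under [iid_law];
   by [Gamma_iid] any other realisation gives the same value. [fine] loses
   nothing when [mu] has a finite first moment, in particular when its moment
   generating function is finite near [0]. *)
Definition Gamma (R : realType) (n : nat) (X : {set {set 'I_n}})
    (mu : probability R R) : R :=
  fine 'E_(iid_law mu n)[fun w => max_sum X (tnth w)].

Definition mutual_independent d (T : measurableType d) (R : realType)
    (P : probability T R) (n : nat) (g : 'I_n -> {RV P >-> R}) : Prop :=
  forall (J : {set 'I_n}) (A : 'I_n -> set R), (forall i, measurable (A i)) ->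
    (P (\bigcap_(i in [set` J]) (g i @^-1` A i)) =
     \prod_(i in J) P (g i @^-1` A i))%E.

Lemma max_sumE (R : realType) (n : nat) (X : {set {set 'I_n}}) (x0 : {set 'I_n})
    (g : 'I_n -> R) : x0 \in X ->
  max_sum X g =
  \big[Num.max/(\sum_(i in x0) g i)%R]_(x in X) \sum_(i in x) g i.
Proof.
move=> x0X; set b := RHS.
have ub x : x \in X -> \sum_(i in x) g i <= b by move=> xX; exact: le_bigmax_cond.
have [x xX bE] : exists2 x, x \in X & b = \sum_(i in x) g i.
  by apply: (big_ind (fun b => exists2 x, x \in X & b = \sum_(i in x) g i));
    [exists x0 | move=> _ _ [y yX ->] [z zX ->]; rewrite maxEle;
      case: ifP => _; [exists z|exists y] | move=> y yX; exists y].
apply/eqP; rewrite eq_le; apply/andP; split.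
  by apply: ge_sup => [|_ [y yX <-]]; [exists b, x | exact: ub].
apply: ub_le_sup; last by exists x.
by exists b => _ [y yX <-]; exact: ub.
Qed.

Lemma iid_law_box (R : realType) (mu : probability R R) (n : nat)
    (A : 'I_n -> set R) : (forall i, measurable (A i)) ->
  (iid_law mu n [set w | forall i, A i (tnth w i)] = \prod_(i < n) mu (A i))%E.
Proof.
elim: n A => [|n IH] A mA.
  by rewrite big_ord0 /= diracE mem_set// => -[].
have mB : measurable [set w : n.-tuple R | forall i, A (lift ord0 i) (tnth w i)].
  rewrite [X in measurable X](_ : _ = \big[setI/setT]_(i < n)
      ((fun w : n.-tuple R => tnth w i) @^-1` A (lift ord0 i))).
    apply: bigsetI_measurable => i _; rewrite -[X in measurable X]setTI.
    exact: measurable_tnth.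
  rewrite -bigcap_seq; apply/seteqP; split => w /= Aw i; first by move=> _; exact: Aw.
  by apply: (Aw i) => /=; rewrite mem_index_enum.
rewrite big_ord_recl -IH// -product_measure1E//=.
congr (_ _); apply/seteqP; split => [[a w]|[a w]] /=.
  by move=> Aw; split => [|i]; [exact: (Aw ord0)|have := Aw (lift ord0 i);
    rewrite /tcons tnthS].
move=> [Aa Aw] i; case: (unliftP ord0 i) => [j ->|-> //].
by rewrite /tcons tnthS; exact: Aw.
Qed.

Lemma Gamma_iid d (T : measurableType d) (R : realType) (P : probability T R)
    (mu : probability R R) (n : nat) (g : 'I_n -> {RV P >-> R})
    (X : {set {set 'I_n}}) :
  mutual_independent g ->
  (forall i A, measurable A -> distribution P (g i) A = mu A) ->
  (0 < #|X|)%N ->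
  Gamma X mu = fine 'E_P[fun w => max_sum X (fun i => g i w)].
Proof.
move=> indep gmu /card_gt0P[x0 x0X]; congr fine.
pose G (w : T) : n.-tuple R := [tuple g i w | i < n].
have mG : measurable_fun [set: T] G.
  apply/measurable_fun_tnthP => i.
  by rewrite (_ : _ \o _ = g i)//; apply/funext => w /=; rewrite tnth_mktuple.
pose S : {mfun T >-> n.-tuple R} :=
  HB.pack G (isMeasurableFun.Build _ _ _ _ G mG).
pose box : set (set (n.-tuple R)) :=
  [set [set w | forall i, A i (tnth w i)] |
    A in [set A : 'I_n -> set R | forall i, measurable (A i)]].
have lawE B : measurable B -> iid_law mu n B = distribution P S B.
  apply: (@measure_unique _ R _ box (fun=> setT)).
  - apply/seteqP; split => C.
      apply: smallest_sub; first exact: smallest_sigma_algebra.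
      rewrite -bigcup_seq => D [i /= _ [A mA <-]].
      apply: sub_sigma_algebra; exists (fun j => if j == i then A else setT) => /=.
        by move=> j; case: ifP.
      apply/seteqP; split => w /=.
        by move=> /(_ i); rewrite eqxx; split.
      by move=> [_ Aw] j; case: eqP => [->|].
    apply: smallest_sub; first exact: sigma_algebra_measurable.
    move=> D [A mA <-].
    rewrite [X in measurable X](_ : _ = \big[setI/setT]_(i < n)
        ((fun w : n.-tuple R => tnth w i) @^-1` A i)).
      apply: bigsetI_measurable => i _; rewrite -[X in measurable X]setTI.
      exact: measurable_tnth.
    rewrite -bigcap_seq; apply/seteqP; split => w /= Aw i; first by move=> _; exact: Aw.
    by apply: (Aw i) => /=; rewrite mem_index_enum.
  - move=> _ _ [A mA <-] [B' mB <-]; exists (fun i => A i `&` B' i).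
      by move=> i; exact: measurableI.
    apply/seteqP; split => w /=; first by move=> H; split => i; case: (H i).
    by move=> [HA HB] i; split.
  - by move=> _; exists (fun=> setT) => //; apply/seteqP; split.
  - by rewrite bigcup_const//; exists 0%N.
  - move=> _ [A mA <-]; rewrite [LHS]iid_law_box//.
    have := indep [set: 'I_n]%SET A mA.
    under [X in _ = X -> _]eq_bigr do rewrite [P _]gmu//.
    rewrite [X in _ = X](eq_bigl xpredT); last by move=> i; rewrite inE.
    move=> <-; rewrite /distribution /pushforward; congr (P _).
    apply/seteqP; split => w /= Aw i.
      by rewrite tnth_mktuple; apply: (Aw i); rewrite /= inE.
    by move=> _; have := Aw i; rewrite tnth_mktuple.
  - by move=> _; rewrite (le_lt_trans (probability_le1 _ _))// ltry.
have mM : measurable_fun [set: n.-tuple R]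
    (EFin \o (fun w => max_sum X (tnth w))).
  apply/measurable_EFinP.
  rewrite (_ : (fun w : n.-tuple R => _) = (fun w : n.-tuple R =>
    \big[Num.max/(\sum_(i in x0) tnth w i)%R]_(x in X) \sum_(i in x) tnth w i));
    last by apply/funext => w; exact: max_sumE.
  have msum (x : {set 'I_n}) : measurable_fun [set: n.-tuple R]
      (fun w => \sum_(i in x) tnth w i).
    rewrite (_ : (fun w => _) = (fun w : n.-tuple R =>
        \sum_(i <- enum x) tnth w i)).
      by apply: measurable_sum => i; exact: measurable_tnth.
    by apply/funext => w; rewrite big_enum.
  have mmax (s : seq {set 'I_n}) : measurable_fun [set: n.-tuple R]
      (fun w => \big[Num.max/(\sum_(i in x0) tnth w i)%R]_(x <- s | x \in X)
        \sum_(i in x) tnth w i).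
    elim: s => [|y s IHs].
      by under eq_fun do rewrite big_nil; exact: msum.
    under eq_fun do rewrite big_cons.
    by case: (y \in X) => //; exact: measurable_maxr.
  exact: mmax.
rewrite unlock.
rewrite (eq_measure_integral (distribution P S)); last first.
  by move=> A mA _; exact: lawE.
rewrite integralE [RHS]integralE.
rewrite !ge0_integral_pushforward//; last 2 first.
  exact: measurable_funeneg.
  exact: measurable_funepos.
rewrite !preimage_setT.
have SE w : max_sum X (tnth (S w)) = max_sum X (fun i => g i w).
  by congr max_sum; apply/funext => i; rewrite tnth_mktuple.
by congr (_ - _)%E; apply: eq_integral => w _;
  rewrite /= ?funeposE ?funenegE /= SE.
Qed.

(* Main.v *)
Require Import Defs.
From HB Require Import structures.
From mathcomp Require Import all_boot all_order all_algebra.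
From mathcomp Require Import all_classical all_reals all_analysis.
From mathcomp Require Import measurable_realfun.
From mathcomp Require Import ring lra.

Set Implicit Arguments.
Unset Strict Implicit.
Unset Printing Implicit Defensive.

Import Order.TTheory GRing.Theory Num.Theory.
Import numFieldNormedType.Exports.

Local Open Scope classical_set_scope.
Local Open Scope ring_scope.

(** Both parts compare the largest of the sums over the members of [X] with
    the exponential moments of one sum.

    Upper bound on [Gamma].  By Jensen's inequality for [exp] and the union
    bound,
      exp (d * Gamma) <= E exp (d * max) <= |X| * L(d)^k,
    and taking logarithms and the supremum over [d >= 0] gives the first part; see
    [expR_Gamma_le] and [rate_Gamma_le].

    Optimality.  Take [m + 1] pairwise disjoint blocks of size [k], so that the
    block sums are independent copies of [S], the sum of [k] variables.  If
    [p = P(S >= k s)] with [s] slightly below [t], one of [m] copies reaches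
    [k s] with probability [1 - (1 - p)^m], and keeping one further block in reserve costs nothing:
    its sum has mean zero by symmetry, so the expected maximum is at least
    [(1 - (1 - p)^m) * k s] ([Gamma_add_block_ge]).  It suffices that [m] be
    somewhat larger than [1 / p], and then [ln |X| <= k (h(t) + eps)] follows
    from Cramer's lower bound [p >= exp (- k (h(t) + eps / 2))], which is
    [cramer_lower].

    Cramer's bound without derivatives.  The generating function may be
    infinite away from [0], so it is first truncated:
      G(d) = \int_[-M, M] exp (d (x - t)) dmu(x).
    For [M] large, [G] stays above [exp (- h - e)] and its near-minimisers on
    [d >= 0] stay in a fixed interval [[0, D]] ([truncated_mgf_ge]).  At a
    near-minimiser [d], the second difference of [G] is of order [l^2], hence
    [G(d + l)] and [G(d - l)] exceed [G(d)] by at most that order: this is the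
    quantitative form of G'(d) = 0 ([balanced_tilt]).  Under the weight
    [exp (d (x - t))] a Chernoff bound with [l] and [- l] then shows that most
    of the total mass [G(d)^k] lies where the sum is within [k th] of [k t],
    and there the weight is at most [exp (d k th)] ([tilted_chernoff]).  Only
    nonnegative functions are integrated in this argument, so that independence
    enters through the product formula [ge0_integral_iid_prod] alone. *)

(** * Integration against the i.i.d. law *)

Lemma ge0_integral_iid_lawS (R : realType) (mu : probability R R) n
    (f : n.+1.-tuple R -> \bar R) :
  measurable_fun setT f -> (forall w, 0 <= f w)%E ->
  (\int[iid_law mu n.+1]_w f w =
   \int[mu]_x \int[iid_law mu n]_w f (tcons (x, w)))%E.
Proof.
move=> mf f0.
transitivity (\int[mu \x iid_law mu n]_z f (tcons z))%E.
  by rewrite [LHS](@ge0_integral_pushforward _ _ _ _ _ (@tcons R n)).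
rewrite fubini_tonelli1//.
by apply: measurableT_comp => //; exact: measurable_tcons.
Qed.

Lemma tcons0 (R : realType) n (x : R) (w : n.-tuple R) :
  tnth (tcons (x, w)) ord0 = x.
Proof. by []. Qed.

Lemma tconsS (R : realType) n (x : R) (w : n.-tuple R) i :
  tnth (tcons (x, w)) (lift ord0 i) = tnth w i.
Proof. exact: tnthS. Qed.

Lemma measurable_tconsr (R : realType) n (x : R) :
  measurable_fun setT (fun w : n.-tuple R => tcons (x, w)).
Proof.
apply: measurableT_comp; first exact: measurable_tcons.
exact: pair1_measurable.
Qed.

Lemma ge0_integral_iid_prod (R : realType) (mu : probability R R) n
    (f : 'I_n -> R -> R) :
  (forall i, measurable_fun setT (f i)) -> (forall i x, 0 <= f i x) ->
  (\int[iid_law mu n]_w (\prod_i f i (tnth w i))%:E =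
   \prod_i \int[mu]_x (f i x)%:E)%E.
Proof.
move=> + f0; elim: n f f0 => [|n IH] f f0 mf.
  rewrite big_ord0; under eq_integral do rewrite big_ord0.
  by rewrite [LHS]integral_dirac// diracT mul1e.
have mp m (g : 'I_m -> R -> R) : (forall i, measurable_fun setT (g i)) ->
    measurable_fun setT (fun w : m.-tuple R => (\prod_i g i (tnth w i))%:E).
  move=> mg; apply/measurable_EFinP; apply: measurable_prod => i _.
  by apply: measurableT_comp => //; exact: measurable_tnth.
rewrite ge0_integral_iid_lawS//; last 2 first.
- exact: mp.
- by move=> w; rewrite lee_fin prodr_ge0.
rewrite big_ord_recl -IH//.
rewrite -ge0_integralZr//.
- apply: eq_integral => x _; rewrite -ge0_integralZl//.
  + apply: eq_integral => w _; rewrite big_ord_recl tcons0 EFinM.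
    congr (_ * _%:E)%E; apply: eq_bigr => i _.
    by rewrite tconsS.
  + exact: (mp _ (fun i => f (lift ord0 i))).
  + by move=> w _; rewrite lee_fin prodr_ge0.
  + by rewrite lee_fin.
- exact/measurable_EFinP.
- by move=> x _; rewrite lee_fin.
- by apply: integral_ge0 => w _; rewrite lee_fin prodr_ge0.
Qed.

Definition tleft (T : Type) a b (w : (a + b).-tuple T) : a.-tuple T :=
  [tuple tnth w (lshift b i) | i < a].

Definition tright (T : Type) a b (w : (a + b).-tuple T) : b.-tuple T :=
  [tuple tnth w (rshift a i) | i < b].

Lemma measurable_tleft (R : realType) a b :
  measurable_fun setT (@tleft R a b).
Proof.
apply/measurable_fun_tnthP => i.
rewrite (_ : _ \o _ = fun w => tnth w (lshift b i)); first exact: measurable_tnth.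
by apply/funext => w /=; rewrite tnth_mktuple.
Qed.

Lemma measurable_tright (R : realType) a b :
  measurable_fun setT (@tright R a b).
Proof.
apply/measurable_fun_tnthP => i.
rewrite (_ : _ \o _ = fun w => tnth w (rshift a i)); first exact: measurable_tnth.
by apply/funext => w /=; rewrite tnth_mktuple.
Qed.

(** Independence of the first [a] coordinates from the last [b]; it lets one
    block of variables be separated from the others. *)
Lemma ge0_integral_iid_split (R : realType) (mu : probability R R) a b
    (f : a.-tuple R -> \bar R) (g : b.-tuple R -> \bar R) :
  measurable_fun setT f -> (forall w, 0 <= f w)%E ->
  measurable_fun setT g -> (forall w, 0 <= g w)%E ->
  (\int[iid_law mu (a + b)]_w (f (tleft w) * g (tright w)) =
   \int[iid_law mu a]_w f w * \int[iid_law mu b]_w g w)%E.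
Proof.
move=> + + mg g0; elim: a f => [|a IH] f mf f0.
  rewrite [X in (_ = X * _)%E]integral_dirac// diracT mul1e.
  rewrite -ge0_integralZl//; apply: eq_integral => w _.
  congr (f _ * g _)%E; first exact: tuple0.
  by apply: eq_from_tnth => i; rewrite tnth_mktuple; congr tnth; exact: val_inj.
rewrite [X in (_ = X * _)%E]ge0_integral_iid_lawS//.
rewrite [LHS](@ge0_integral_iid_lawS _ mu (a + b)
  (fun w : (a + b).+1.-tuple R => f (tleft (w : (a.+1 + b).-tuple R)) *
     g (tright (w : (a.+1 + b).-tuple R))))%E; last 2 first.
- apply: emeasurable_funM; apply: measurableT_comp => //.
    exact: (@measurable_tleft R a.+1 b).
  exact: (@measurable_tright R a.+1 b).
- by move=> w; rewrite mule_ge0.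
have mfx x : measurable_fun setT (fun w : a.-tuple R => f (tcons (x, w))).
  by apply: measurableT_comp => //; exact: measurable_tconsr.
rewrite -ge0_integralZr//; last 3 first.
- apply: (@measurable_fun_fubini_tonelli_F _ _ _ _ _ (iid_law mu a)
    (f \o @tcons R a)) => //=.
  by apply: measurableT_comp => //; exact: measurable_tcons.
- by move=> x _; exact: integral_ge0.
- exact: integral_ge0.
apply: eq_integral => x _; rewrite -IH//.
apply: eq_integral => w _.
congr (f _ * g _)%E; apply: eq_from_tnth => i; rewrite tnth_mktuple.
  case: (unliftP ord0 i) => [j ->|->].
    rewrite tconsS tnth_mktuple -(tconsS x w); congr tnth; exact: val_inj.
  by rewrite tcons0 -[RHS](tcons0 x w); congr tnth; exact: val_inj.
rewrite tnth_mktuple -(tconsS x w); congr tnth; exact: val_inj.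
Qed.

(** * Moments of a symmetric law, and of sums of its i.i.d. copies *)

Lemma symmetric_ge0_integral (R : realType) (mu : probability R R)
    (f : R -> \bar R) :
  symmetric_measure mu -> measurable_fun setT f -> (forall x, 0 <= f x)%E ->
  (\int[mu]_x f (- x)%R = \int[mu]_x f x)%E.
Proof.
move=> sym mf f0.
have mN : measurable_fun [set: R] (-%R : R -> R) by exact: oppr_measurable.
rewrite [RHS](eq_measure_integral (pushforward mu (-%R : R -> R))); last first.
  move=> A mA _; apply: (eq_trans (sym A mA)); congr (mu _).
  apply/seteqP; split => [_ [x Ax <-]|x /= Ax]; first by rewrite /= opprK.
  by exists (- x); rewrite ?opprK.
by rewrite ge0_integral_pushforward.
Qed.

(** Linear growth is dominated by exponential growth on both sides, so a
    moment generating function finite at [r] and [- r] gives a first moment. *)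
Lemma abs_le_expR (R : realType) (r x : R) : 0 < r ->
  `|x| <= r^-1 * (expR (r * x) + expR (- r * x)).
Proof.
move=> r0; rewrite ler_pdivlMl//.
have := expR_ge1Dx (r * x); have := expR_ge1Dx (- r * x).
have := expR_gt0 (r * x); have := expR_gt0 (- r * x).
by case: (ler0P x) => ? ? ? ? ?; lra.
Qed.

Lemma mgf_fin_integrable (R : realType) (mu : probability R R) :
  (\forall delta \near (0 : R), (mgf mu delta < +oo)%E) ->
  mu.-integrable setT (EFin : R -> \bar R).
Proof.
move=> /nbhs_ballP[e /= e0 he].
have fin r : `|r| < e -> (\int[mu]_x (expR (r * x))%:E < +oo)%E.
  by move=> re; rewrite -mgfE; apply: he; rewrite /ball /= sub0r normrN.
have mexp r : measurable_fun [set: R] (fun x : R => (expR (r * x))%:E).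
  apply/measurable_EFinP/measurableT_comp => //; exact: measurable_funM.
have e2 : 0 < e / 2 by rewrite divr_gt0.
have iexp r : `|r| < e -> mu.-integrable setT (fun x : R => (expR (r * x))%:E).
  move=> re; apply/integrableP; split => //.
  under eq_integral do rewrite gee0_abs ?lee_fin ?expR_ge0//.
  exact: fin.
have e2e : `|e / 2| < e by rewrite gtr0_norm//; lra.
apply: (@le_integrable _ _ _ _ _ _ _ (fun x => (e / 2)^-1%:E *
  ((expR (e / 2 * x))%:E + (expR (- (e / 2) * x))%:E))%E) => //.
- move=> x _; rewrite -EFinD -EFinM !abse_EFin lee_fin [leRHS]ger0_norm.
    exact: abs_le_expR.
  by rewrite mulr_ge0 ?addr_ge0 ?expR_ge0// invr_ge0 ltW.
- apply: integrableZl => //; apply: integrableD => //; apply: iexp => //.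
  by rewrite normrN.
Qed.

Lemma symmetric_mean0 (R : realType) (mu : probability R R) :
  symmetric_measure mu -> mu.-integrable setT (EFin : R -> \bar R) ->
  (\int[mu]_x x%:E = 0)%E.
Proof.
move=> sym imu; rewrite integralE.
have mE : measurable_fun [set: R] (EFin : R -> \bar R) by exact/measurable_EFinP.
rewrite (_ : \int[mu]_x _^\- x = \int[mu]_x (EFin : R -> \bar R)^\+ x)%E.
  by rewrite subee//; exact: integrable_pos_fin_num.
rewrite -[RHS]symmetric_ge0_integral//; last exact: measurable_funepos.
by apply: eq_integral => x _; rewrite funeposE funenegE EFinN.
Qed.

Lemma ge0_integral_iid_coord (R : realType) (mu : probability R R) n (i : 'I_n)
    (f : R -> R) : measurable_fun setT f -> (forall x, 0 <= f x) ->
  (\int[iid_law mu n]_w (f (tnth w i))%:E = \int[mu]_x (f x)%:E)%E.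
Proof.
move=> mf f0; pose F j : R -> R := if j == i then f else cst 1.
transitivity (\int[iid_law mu n]_w (\prod_j F j (tnth w j))%:E)%E.
  apply: eq_integral => w _; rewrite /F (bigD1 i)//= eqxx big1 ?mulr1//.
  by move=> j /negbTE ->.
rewrite ge0_integral_iid_prod /F; last 2 first.
- by move=> j; case: ifP.
- by move=> j x; case: ifP.
rewrite (bigD1 i)//= eqxx big1 ?mule1//.
move=> j /negbTE ->; rewrite [LHS](integral_cst mu measurableT 1%E) mul1e.
exact: probability_setT.
Qed.

Lemma integrable_iid_coord (R : realType) (mu : probability R R) n (i : 'I_n) :
  mu.-integrable setT (EFin : R -> \bar R) ->
  (iid_law mu n).-integrable setT (fun w => (tnth w i)%:E).
Proof.
move=> /integrableP[_ fin]; apply/integrableP; split.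
  by apply/measurable_EFinP; exact: measurable_tnth.
under eq_integral do rewrite abse_EFin.
by rewrite (ge0_integral_iid_coord mu i (f := fun x => `|x|)).
Qed.

Lemma integral_iid_coord (R : realType) (mu : probability R R) n (i : 'I_n) :
  (\int[iid_law mu n]_w (tnth w i)%:E = \int[mu]_x x%:E)%E.
Proof.
rewrite integralE [RHS]integralE; congr (_ - _)%E.
  under eq_integral do rewrite funeposE -EFin_max.
  rewrite (ge0_integral_iid_coord mu i (f := fun x => Num.max x 0)).
  - by apply: eq_integral => x _; rewrite funeposE EFin_max.
  - exact: measurable_maxr.
  - by move=> x; rewrite le_max lexx orbT.
under eq_integral do rewrite funenegE -EFinN -EFin_max.
rewrite (ge0_integral_iid_coord mu i (f := fun x => Num.max (- x) 0)).
- by apply: eq_integral => x _; rewrite funenegE EFin_max.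
- exact: measurable_maxr.
- by move=> x; rewrite le_max lexx orbT.
Qed.

Lemma integrable_iid_sum (R : realType) (mu : probability R R) n (x : {set 'I_n}) :
  mu.-integrable setT (EFin : R -> \bar R) ->
  (iid_law mu n).-integrable setT (fun w => (\sum_(i in x) tnth w i)%:E).
Proof.
move=> imu; under eq_fun do rewrite -sumEFin.
by apply: integrable_sum => // i _; exact: integrable_iid_coord.
Qed.

Lemma integral_iid_sum (R : realType) (mu : probability R R) n (x : {set 'I_n}) :
  symmetric_measure mu -> mu.-integrable setT (EFin : R -> \bar R) ->
  (\int[iid_law mu n]_w (\sum_(i in x) tnth w i)%:E = 0)%E.
Proof.
move=> sym imu; under eq_integral do rewrite -sumEFin.
rewrite integral_sum//; last by move=> i; exact: integrable_iid_coord.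
by rewrite big1// => i _; rewrite integral_iid_coord symmetric_mean0.
Qed.

Lemma max_sum_attained (R : realType) n (X : {set {set 'I_n}}) (g : 'I_n -> R) :
  (0 < #|X|)%N -> exists2 x, x \in X & max_sum X g = \sum_(i in x) g i.
Proof.
move=> /card_gt0P[x0 x0X]; rewrite (max_sumE _ x0X).
apply: (big_ind (fun b => exists2 x, x \in X & b = \sum_(i in x) g i)).
- by exists x0.
- move=> _ _ [y yX ->] [z zX ->]; rewrite maxEle.
  by case: ifP => _; [exists z|exists y].
- by move=> y yX; exists y.
Qed.

Lemma sum_le_max_sum (R : realType) n (X : {set {set 'I_n}}) (g : 'I_n -> R) x :
  x \in X -> \sum_(i in x) g i <= max_sum X g.
Proof. by move=> xX; rewrite (max_sumE _ xX); exact: le_bigmax_cond. Qed.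

Lemma measurable_tnth_sum (R : realType) n (x : {set 'I_n}) :
  measurable_fun setT (fun w : n.-tuple R => \sum_(i in x) tnth w i).
Proof.
under eq_fun do rewrite -big_enum.
by apply: measurable_sum => i; exact: measurable_tnth.
Qed.

Lemma measurable_max_sum (R : realType) n (X : {set {set 'I_n}}) :
  (0 < #|X|)%N -> measurable_fun setT (fun w : n.-tuple R => max_sum X (tnth w)).
Proof.
move=> /card_gt0P[x0 x0X]; under eq_fun do rewrite (max_sumE _ x0X).
have mmax (s : seq {set 'I_n}) : measurable_fun setT (fun w : n.-tuple R =>
    \big[Num.max/(\sum_(i in x0) tnth w i)%R]_(x <- s | x \in X)
      \sum_(i in x) tnth w i).
  elim: s => [|y s IHs].
    by under eq_fun do rewrite big_nil; exact: measurable_tnth_sum.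
  under eq_fun do rewrite big_cons.
  case: (y \in X) => //; apply: measurable_maxr => //.
  exact: measurable_tnth_sum.
exact: mmax.
Qed.

(** The maximum is one of the sums, hence at most the sum of all the
    [`|tnth w i|] in absolute value. *)
Lemma integrable_max_sum (R : realType) (mu : probability R R) n
    (X : {set {set 'I_n}}) :
  mu.-integrable setT (EFin : R -> \bar R) -> (0 < #|X|)%N ->
  (iid_law mu n).-integrable setT (fun w => (max_sum X (tnth w))%:E).
Proof.
move=> imu X0.
apply: (@le_integrable _ _ _ (iid_law mu n) setT measurableT _
  (fun w : n.-tuple R => (\sum_i `|tnth w i|)%:E)) => //.
- by apply/measurable_EFinP; exact: measurable_max_sum.
- move=> w _; rewrite !abse_EFin lee_fin [leRHS]ger0_norm ?sumr_ge0//.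
  have [x xX ->] := max_sum_attained (tnth w) X0.
  apply: (le_trans (ler_norm_sum _ _ _)).
  by rewrite [leLHS]big_mkcond; apply: ler_sum => i _; case: ifP.
- under eq_fun do rewrite -sumEFin.
  apply: integrable_sum => // i _.
  have := integrable_abse (integrable_iid_coord i imu).
  by apply: eq_integrable => // w _.
Qed.

Lemma integral_iid_expR_sum (R : realType) (mu : probability R R) n
    (x : {set 'I_n}) (d l : R) : mgf mu d = l%:E ->
  (\int[iid_law mu n]_w (expR (d * \sum_(i in x) tnth w i))%:E = (l ^+ #|x|)%:E)%E.
Proof.
move=> dl; pose F i : R -> R := if i \in x then fun y => expR (d * y) else cst 1.
transitivity (\int[iid_law mu n]_w (\prod_i F i (tnth w i))%:E)%E.
  apply: eq_integral => w _; rewrite /F mulr_sumr expR_sum big_mkcond /=.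
  by congr (_%:E); apply: eq_bigr => i _; case: ifP.
rewrite ge0_integral_iid_prod /F; last 2 first.
- by move=> j; case: ifP => // _; apply: measurableT_comp => //.
- by move=> j y; case: ifP => // _; exact: expR_ge0.
rewrite (eq_bigr (fun i => (if i \in x then l else 1)%:E)); last first.
  move=> i _; case: ifP => _; first by rewrite -dl mgfE.
  by rewrite [LHS](integral_cst mu measurableT 1%E) mul1e; exact: probability_setT.
by rewrite prodEFin -big_mkcond prodr_const.
Qed.

(** * Exponential moments bound the expected maximum *)

Lemma GammaE (R : realType) (mu : probability R R) n (X : {set {set 'I_n}}) :
  mu.-integrable setT (EFin : R -> \bar R) -> (0 < #|X|)%N ->
  (\int[iid_law mu n]_w (max_sum X (tnth w))%:E = (Gamma X mu)%:E)%E.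
Proof.
move=> imu X0; rewrite /Gamma unlock fineK//.
by apply: integrable_fin_num => //; exact: integrable_max_sum.
Qed.

(** Jensen's inequality in the form of the tangent line of [exp] at
    [c = d * Gamma], which needs the maximum to be integrable, followed by
    bounding the exponential of the maximum by the sum of all exponentials. *)
Lemma expR_Gamma_le (R : realType) (mu : probability R R) n k
    (X : {set {set 'I_n}}) (d l : R) :
  mu.-integrable setT (EFin : R -> \bar R) -> (0 < #|X|)%N ->
  (forall x, x \in X -> #|x| = k) -> mgf mu d = l%:E ->
  expR (d * Gamma X mu) <= #|X|%:R * l ^+ k.
Proof.
move=> imu X0 Xk dl; set c := d * Gamma X mu.
have iM := integrable_max_sum imu X0.
have mexp (x : {set 'I_n}) : measurable_fun setT
    (fun w : n.-tuple R => (expR (d * \sum_(i in x) tnth w i))%:E).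
  apply/measurable_EFinP/measurableT_comp => //; apply: measurable_funM => //.
  exact: measurable_tnth_sum.
have iS (x : {set 'I_n}) : (iid_law mu n).-integrable setT
    (fun w => (expR (d * \sum_(i in x) tnth w i))%:E).
  apply/integrableP; split => //.
  under eq_integral do rewrite gee0_abs ?lee_fin ?expR_ge0//.
  by rewrite (integral_iid_expR_sum _ dl) ltry.
have icst (r : R) : (iid_law mu n).-integrable setT (fun=> r%:E).
  exact: finite_measure_integrable_cst.
have lhsE : (\int[iid_law mu n]_w
   (expR c * (1 - c) + expR c * d * max_sum X (tnth w))%:E = (expR c)%:E)%E.
  under eq_integral do rewrite EFinD [X in (_ + X)%E]EFinM.
  rewrite integralD//; last exact: integrableZl.
  rewrite integralZl// GammaE// integral_cst// [X in (_ * X)%E]probability_setT.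
  by rewrite mule1 -EFinM -EFinD; congr EFin; rewrite /c; ring.
have rhsE : (\int[iid_law mu n]_w
   \sum_(x in X) (expR (d * \sum_(i in x) tnth w i))%:E =
   (#|X|%:R * l ^+ k)%:E)%E.
  rewrite integral_sum//.
  under eq_bigr => x xX do rewrite (integral_iid_expR_sum _ dl) Xk//.
  by rewrite sumEFin sumr_const mulr_natl.
rewrite -lee_fin -lhsE -rhsE; apply: le_integral => //.
- under eq_fun do rewrite EFinD [X in (_ + X)%E]EFinM.
  by apply: integrableD => //; exact: integrableZl.
- exact: integrable_sum.
move=> w _; rewrite sumEFin lee_fin.
have [x xX Mx] := max_sum_attained (tnth w) X0.
apply: (@le_trans _ _ (expR (d * max_sum X (tnth w)))).
  have := expR_ge1Dx (d * max_sum X (tnth w) - c).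
  rewrite -(ler_pM2l (expR_gt0 c)) -expRD subrKC => /(le_trans _); apply.
  by rewrite le_eqVlt; apply/orP; left; apply/eqP; ring.
by rewrite Mx (bigD1 x)//= lerDl sumr_ge0// => y _; exact: expR_ge0.
Qed.

Lemma rate_Gamma_le (R : realType) (mu : probability R R) k n
    (X : {set {set 'I_n}}) :
  mu.-integrable setT (EFin : R -> \bar R) -> (0 < k)%N -> (0 < #|X|)%N ->
  (forall x, x \in X -> #|x| = k) ->
  (rate mu (k%:R^-1 * Gamma X mu) <= (k%:R^-1 * ln #|X|%:R)%:E)%E.
Proof.
move=> imu k0 X0 Xk; apply: ge_ereal_sup => _ [d /= d0 <-].
have mgf0 : (0 <= mgf mu d)%E.
  by rewrite mgfE; apply: integral_ge0 => x _; rewrite lee_fin expR_ge0.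
case E : (mgf mu d) mgf0 => [l| |]//; last by rewrite /= leNye.
rewrite lee_fin => l0.
have := expR_Gamma_le imu X0 Xk E.
have N0 : 0 < #|X|%:R :> R by rewrite ltr0n.
have kR : 0 < k%:R :> R by rewrite ltr0n.
have [l0E|lN0] := eqVneq l 0.
  by rewrite l0E expr0n eqn0Ngt k0 mulr0 leNgt expR_gt0.
have {l0 lN0}l0 : 0 < l by rewrite lt_neqAle eq_sym lN0.
rewrite -[X in _ <= X]lnK; last by rewrite posrE mulr_gt0// exprn_gt0.
rewrite ler_expR lnM ?posrE ?exprn_gt0// lnXn// => H.
rewrite lne_EFin// -EFinB lee_fin -(ler_pM2l kR) mulrBr mulVKf ?gt_eqF//.
by rewrite mulrCA mulVKf ?gt_eqF// lerBlDr mulr_natl.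
Qed.

(** * Families of disjoint blocks *)

Definition all_below (R : realType) n (X : {set {set 'I_n}}) (s : R) :
    set (n.-tuple R) :=
  [set w | forall x, x \in X -> \sum_(i in x) tnth w i < s].

(** A family on [n] indices is shifted past [k] new indices, which form one
    more member of the family.  Placing the new block first matches the
    splitting of tuples by [tleft] and [tright]. *)
Definition add_block k n (X : {set {set 'I_n}}) : {set {set 'I_(k + n)}} :=
  (@lshift k n @: [set: 'I_k] |: [set @rshift k n @: (x : {set 'I_n}) | x in X])%SET.

Lemma sum_lshift (R : realType) k n (w : (k + n).-tuple R) :
  \sum_(i in (@lshift k n @: [set: 'I_k])%SET) tnth w i =
  \sum_(i in [set: 'I_k]%SET) tnth (tleft w) i.
Proof.
rewrite big_imset/=; last by move=> i j _ _; exact: lshift_inj.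
by apply: eq_bigr => i _; rewrite tnth_mktuple.
Qed.

Lemma sum_rshift (R : realType) k n (w : (k + n).-tuple R) (x : {set 'I_n}) :
  \sum_(i in (@rshift k n @: x)%SET) tnth w i = \sum_(i in x) tnth (tright w) i.
Proof.
rewrite big_imset/=; last by move=> i j _ _; exact: rshift_inj.
by apply: eq_bigr => i _; rewrite tnth_mktuple.
Qed.

Lemma all_below_add_block (R : realType) k n (X : {set {set 'I_n}}) (s : R)
    (w : (k + n).-tuple R) :
  all_below (add_block k X) s w <->
  all_below [set [set: 'I_k]]%SET s (tleft w) /\ all_below X s (tright w).
Proof.
split=> [H|[Hl Hr] _ /setU1P[->|/imsetP[x xX ->]]]; first split=> x.
- by rewrite inE => /eqP ->; rewrite -sum_lshift; apply: H; rewrite setU11.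
- move=> xX; rewrite -sum_rshift; apply: H.
  by apply/setU1P; right; apply/imsetP; exists x.
- by rewrite sum_lshift; apply: Hl; rewrite inE.
- by rewrite sum_rshift; exact: Hr.
Qed.

Lemma card_add_block k n (X : {set {set 'I_n}}) :
  (#|add_block k X| <= #|X|.+1)%N.
Proof.
rewrite /add_block cardsU1 -[#|X|.+1]add1n leq_add// ?leq_b1//.
exact: leq_imset_card.
Qed.

Lemma card_in_add_block k n (X : {set {set 'I_n}}) :
  (forall x, x \in X -> #|x| = k) ->
  forall x, x \in add_block k X -> #|x| = k.
Proof.
move=> Xk _ /setU1P[->|/imsetP[x xX ->]].
  by rewrite card_imset ?cardsT ?card_ord//; exact: lshift_inj.
by rewrite card_imset ?Xk//; exact: rshift_inj.
Qed.

Lemma measurable_all_below (R : realType) n (X : {set {set 'I_n}}) (s : R) :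
  measurable (all_below X s).
Proof.
rewrite (_ : all_below X s = \big[setI/setT]_(x in X)
  ((fun w : n.-tuple R => \sum_(i in x) tnth w i) @^-1` `]-oo, s[)).
  apply: bigsetI_measurable => x _; rewrite -[X in measurable X]setTI.
  exact: measurable_tnth_sum.
rewrite -bigcap_seq_cond; apply/seteqP; split => w /= wX x.
  by case/andP => _ xX; rewrite /= in_itv /=; exact: wX.
move=> xX; have := wX x; rewrite /= in_itv /=; apply.
by rewrite mem_index_enum.
Qed.

Lemma iid_law_all_below_add_block (R : realType) (mu : probability R R) k n
    (X : {set {set 'I_n}}) (s : R) :
  (iid_law mu (k + n) (all_below (add_block k X) s) =
   iid_law mu k (all_below [set [set: 'I_k]]%SET s) *
   iid_law mu n (all_below X s))%E.
Proof.
have mA j Y := @measurable_all_below R j Y s.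
have mI j (Y : {set {set 'I_j}}) :
    measurable_fun setT (fun w : j.-tuple R => (\1_(all_below Y s) w : R)%:E).
  by apply/measurable_EFinP; apply: measurable_indic; exact: measurable_all_below.
have lawE j (Y : {set {set 'I_j}}) : iid_law mu j (all_below Y s) =
    (\int[iid_law mu j]_w (\1_(all_below Y s) w)%:E)%E.
  by rewrite integral_indic ?setIT//; exact: mA.
rewrite !lawE -ge0_integral_iid_split//.
apply: eq_integral => w _; rewrite -EFinM !indicE -natrM mulnb.
congr ((nat_of_bool _)%:R%:E).
apply/idP/idP; rewrite in_setE.
  by case/all_below_add_block => *; rewrite !mem_set.
by case/andP => ? ?; apply/all_below_add_block; split; exact: set_mem.
Qed.

(** The blocks depend on disjoint sets of coordinates, so the probability
    that all of them stay below [s] is a power. *)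
Lemma disjoint_blocks (R : realType) (mu : probability R R) k m (s : R) :
  exists X : {set {set 'I_(m * k)}},
    [/\ (#|X| <= m)%N, forall x, x \in X -> #|x| = k &
        (iid_law mu (m * k) (all_below X s) =
         iid_law mu k (all_below [set [set: 'I_k]]%SET s) ^+ m)%E].
Proof.
elim: m => [|m [X [Xm Xk Xs]]].
  exists finset.set0; split; rewrite ?cards0//; first by move=> x; rewrite inE.
  rewrite expe0 (_ : all_below _ _ = setT) ?[LHS]probability_setT//.
  by apply/seteqP; split => // w _ x; rewrite inE.
rewrite mulSn; exists (add_block k X); split.
- exact: leq_trans (card_add_block k X) _.
- exact: card_in_add_block.
- by rewrite iid_law_all_below_add_block Xs expeS.
Qed.

(** * The expected maximum over disjoint blocks *)

(** Let [S] be the sum over the new block and [A] the event that some other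
    member reaches [s].  Since [E S = 0], [Gamma] is the expectation of
    [max - S], which is nonnegative everywhere and at least [s - S] on [A].
    As [A] is independent of [S], the expectation is at least
    [P(A) * E (s - S)^+ >= P(A) * s]. *)
Lemma Gamma_add_block_ge (R : realType) (mu : probability R R) k n
    (X : {set {set 'I_n}}) (s : R) :
  symmetric_measure mu -> mu.-integrable setT (EFin : R -> \bar R) ->
  (0 <= s) ->
  (iid_law mu n (~` all_below X s) * s%:E <= (Gamma (add_block k X) mu)%:E)%E.
Proof.
move=> sym imu s0; set Y := add_block k X; set L := (@lshift k n @: [set: 'I_k])%SET.
have LY : L \in Y by rewrite setU11.
have Y0 : (0 < #|Y|)%N by apply/card_gt0P; exists L.
pose below (w : k.-tuple R) : R := Num.max (s - \sum_(i in [set: 'I_k]%SET) tnth w i) 0.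
have below0 w : 0 <= below w by rewrite le_max lexx orbT.
have mbelow : measurable_fun setT (fun w => (below w)%:E).
  apply/measurable_EFinP; apply: measurable_maxr => //; apply: measurable_funB => //.
  exact: measurable_tnth_sum.
have mA : measurable (~` all_below X s).
  by apply: measurableC; exact: measurable_all_below.
have mI : measurable_fun setT
    (fun w : n.-tuple R => (\1_(~` all_below X s) w : R)%:E).
  by apply/measurable_EFinP; exact: measurable_indic.
have iL := integrable_iid_sum [set: 'I_k]%SET imu.
have sbelow : (s%:E <= \int[iid_law mu k]_w (below w)%:E)%E.
  have -> : (s%:E = \int[iid_law mu k]_w
      (s%:E - (\sum_(i in [set: 'I_k]%SET) tnth w i)%:E))%E.
    rewrite integralB//; last exact: finite_measure_integrable_cst.
    rewrite integral_iid_sum// sube0 integral_cst//.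
    by rewrite [X in (_ * X)%E]probability_setT mule1.
  apply: le_integral => //.
  - by apply: integrableB => //; exact: finite_measure_integrable_cst.
  - apply: (@le_integrable _ _ _ (iid_law mu k) setT measurableT _ (fun w : k.-tuple R =>
      (s%:E - (\sum_(i in [set: 'I_k]%SET) tnth w i)%:E)%E)) => //.
      move=> w _; rewrite -EFinB !abse_EFin lee_fin ger0_norm// /below.
      by rewrite ge_max ler_norm normr_ge0.
    by apply: integrableB => //; exact: finite_measure_integrable_cst.
  - by move=> w _; rewrite -EFinB lee_fin le_max lexx.
have iM := integrable_max_sum imu Y0; have iLn := integrable_iid_sum L imu.
have -> : ((Gamma Y mu)%:E = \int[iid_law mu (k + n)]_w
    ((max_sum Y (tnth w))%:E - (\sum_(i in L) tnth w i)%:E))%E.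
  by rewrite integralB// GammaE// integral_iid_sum// sube0.
apply: (@le_trans _ _ (\int[iid_law mu (k + n)]_w
   ((below (tleft w))%:E * (\1_(~` all_below X s) (tright w))%:E))%E).
  rewrite (ge0_integral_iid_split mu mbelow _ mI)//.
  by rewrite integral_indic// setIT muleC lee_wpmul2r//.
apply: ge0_le_integral => //.
- by move=> w _; rewrite -EFinM lee_fin mulr_ge0.
- apply: emeasurable_funM.
    by apply: (measurableT_comp mbelow); exact: measurable_tleft.
  by apply: (measurableT_comp mI); exact: measurable_tright.
- apply: emeasurable_funB; first exact: (measurable_int _ iM).
  exact: (measurable_int _ iLn).
move=> w _; rewrite -EFinB -EFinM lee_fin indicE.
have ML : \sum_(i in L) tnth w i <= max_sum Y (tnth w) by exact: sum_le_max_sum.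
case: (boolP (_ \in _)) => [|_]; last by rewrite mulr0 subr_ge0.
rewrite mulr1 in_setE => /existsNP[x /not_implyP[xX /negP]]; rewrite -leNgt => sx.
rewrite /below ge_max subr_ge0 ML andbT -sum_lshift lerB//.
rewrite (le_trans sx)// -sum_rshift sum_le_max_sum//.
by apply/setU1P; right; apply/imsetP; exists x.
Qed.

Lemma measurable_sum_ge (R : realType) k (s : R) :
  measurable [set w : k.-tuple R | s <= \sum_i tnth w i].
Proof.
rewrite (_ : [set w : k.-tuple R | s <= _] =
    setT `&` (fun w : k.-tuple R => \sum_i tnth w i) @^-1` `[s, +oo[).
  by apply: measurable_sum => // i; exact: measurable_tnth.
by rewrite setTI; apply/seteqP; split => w /=; rewrite in_itv /= andbT.
Qed.

(** With [m + 1] blocks, one is spent as the reserve block and the other [m]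
    are independent attempts to reach [s]. *)
Lemma family_Gamma_ge (R : realType) (mu : probability R R) k m (s p : R) :
  symmetric_measure mu -> mu.-integrable setT (EFin : R -> \bar R) -> 0 <= s ->
  (p%:E <= iid_law mu k [set w | (s <= \sum_i tnth w i)%R])%E ->
  exists (n : nat) (X : {set {set 'I_n}}),
    [/\ (0 < #|X|)%N, (#|X| <= m.+1)%N, forall x, x \in X -> #|x| = k &
        (1 - (1 - p) ^+ m) * s <= Gamma X mu].
Proof.
move=> sym imu s0 ps; have [X [Xm Xk Xs]] := disjoint_blocks mu k m s.
exists (k + m * k)%N, (add_block k X); split.
- by apply/card_gt0P; exists (@lshift k (m * k) @: [set: 'I_k])%SET; rewrite setU11.
- exact: leq_trans (card_add_block k X) _.
- exact: card_in_add_block.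
rewrite -lee_fin; apply: le_trans (Gamma_add_block_ge k X sym imu s0).
have mB := @measurable_all_below R.
rewrite EFinM; apply: lee_wpmul2r; first by rewrite lee_fin.
rewrite [leRHS]probability_setC//; last exact: mB.
rewrite Xs; set A := all_below [set [set: 'I_k]]%SET s.
have mA : measurable A by exact: mB.
have Afin : iid_law mu k A \is a fin_num by exact: fin_num_measure.
have {ps} : (iid_law mu k A <= (1 - p)%:E)%E.
  have : (p%:E <= iid_law mu k (~` A))%E.
    apply: le_trans ps _; apply: le_measure; rewrite ?inE.
    - exact: measurable_sum_ge.
    - exact: measurableC.
    move=> w /= sw /(_ [set: 'I_k]%SET); rewrite inE eqxx => /(_ isT).
    by rewrite ltNge (eq_bigl xpredT) ?sw// => i; rewrite inE.
  by rewrite probability_setC// -(fineK Afin) -EFinB !lee_fin; lra.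
rewrite -(fineK Afin) -EFin_expe -!EFinB !lee_fin => le1p.
by rewrite lerB// lerXn2r ?nnegrE// ?fine_ge0// (le_trans _ le1p)// fine_ge0.
Qed.

(** * Truncated exponential moments *)

(** Multiply the tangent inequalities [exp v * (1 - v) <= 1] at [v = u] and
    [v = - u] by [1 + u] and [1 - u]: this gives
    [2 cosh u <= 2 / (1 - u^2)]. *)
Lemma expR_cosh_le (R : realType) (u : R) : `|u| <= 1 / 2 ->
  expR u + expR (- u) <= 2 + 4 * u ^+ 2.
Proof.
have bound v : `|v| <= 1 / 2 -> expR v * (1 - v) <= 1 :> R.
  move=> v2; have := expR_ge1Dx (- v).
  by rewrite -(ler_pM2l (expR_gt0 v)) expRxMexpNx_1.
move=> u2; have h1 := bound u u2.
have h2 : expR (- u) * (1 + u) <= 1.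
  by have := bound (- u); rewrite normrN opprK; exact.
move: u2; rewrite ler_norml => /andP[u1 u2].
have d1 : 0 < 1 - u by lra.
have d2 : 0 < 1 + u by lra.
have d3 : 0 < 1 - u ^+ 2 by nra.
rewrite -(ler_pM2r d3).
have -> : (expR u + expR (- u)) * (1 - u ^+ 2) =
  expR u * (1 - u) * (1 + u) + expR (- u) * (1 + u) * (1 - u) by ring.
apply: (@le_trans _ _ (1 * (1 + u) + 1 * (1 - u))).
  by rewrite lerD// ler_wpM2r// ltW.
have q0 : 0 <= u ^+ 2 by exact: sqr_ge0.
have q1 : u ^+ 2 <= 1 / 4 by nra.
by move: (u ^+ 2) q0 q1 => q q0 q1; nra.
Qed.

Lemma expR_cosh_mono (R : realType) (u v : R) : `|u| <= `|v| ->
  expR u + expR (- u) <= expR v + expR (- v).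
Proof.
have coshN (x : R) : expR `|x| + expR (- `|x|) = expR x + expR (- x).
  by case: ger0P => // _; rewrite opprK addrC.
rewrite -(coshN u) -(coshN v).
move: (normr_ge0 u); move: `|u| `|v| => {coshN}{}u {}v u0 uv.
have e1 : expR u <= expR v by rewrite ler_expR.
have e2 : expR (- u - v) <= 1 by rewrite -expR0 ler_expR; lra.
rewrite -subr_ge0.
have -> : expR v + expR (- v) - (expR u + expR (- u)) =
    (expR v - expR u) * (1 - expR (- u - v)).
  have uu := expRxMexpNx_1 u; have vv := expRxMexpNx_1 v.
  by rewrite expRD; ring: uu vv.
by rewrite mulr_ge0// subr_ge0.
Qed.

(** Centering at [t] makes the infimum of [tmgf mu M t] over [d >= 0] equal to
    [exp (- h(t))] up to truncation, so that no factor
    [exp (- d * t)] has to be carried through the tilting argument. *)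
Definition tilt (R : realType) (M : nat) (t d x : R) : R :=
  expR (d * (x - t)) * \1_(`[- M%:R, M%:R]%classic) x.

Definition tmgf (R : realType) (mu : probability R R) (M : nat) (t d : R) : R :=
  fine (\int[mu]_x (tilt M t d x)%:E).

Section truncation.
Context (R : realType) (mu : probability R R).
Implicit Types (M : nat) (t d x l : R).

Lemma tilt_ge0 M t d x : 0 <= tilt M t d x.
Proof. by rewrite mulr_ge0 ?expR_ge0// indicE ler0n. Qed.

Lemma measurable_tilt M t d : measurable_fun setT (tilt M t d).
Proof.
apply: measurable_funM; last exact: measurable_indic.
apply: measurableT_comp => //; apply: measurable_funM => //.
exact: measurable_funB.
Qed.

Lemma measurable_EFin_tilt M t d : measurable_fun setT (fun x => (tilt M t d x)%:E).
Proof. by apply/measurable_EFinP; exact: measurable_tilt. Qed.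

Lemma tilt_case M t d x : `|x| <= M%:R /\ tilt M t d x = expR (d * (x - t)) \/
  ~ (`|x| <= M%:R) /\ tilt M t d x = 0.
Proof.
rewrite /tilt indicE mem_setE in_itv /= -ler_norml.
by case: (`|x| <= _); [left|right]; rewrite ?mulr1 ?mulr0.
Qed.

Lemma tmgfE M t d : (\int[mu]_x (tilt M t d x)%:E = (tmgf mu M t d)%:E)%E.
Proof.
rewrite /tmgf fineK// ge0_fin_numE; last first.
  by apply: integral_ge0 => x _; rewrite lee_fin tilt_ge0.
apply: (@le_lt_trans _ _ (\int[mu]_x (expR (`|d| * (M%:R + `|t|)))%:E)%E).
  apply: ge0_le_integral => //.
  - by move=> x _; rewrite lee_fin tilt_ge0.
  - exact: measurable_EFin_tilt.
  move=> x _; rewrite lee_fin.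
  case: (tilt_case M t d x) => -[xM ->]; last exact: expR_ge0.
  rewrite ler_expR (le_trans (ler_norm _))// normrM ler_wpM2l//.
  by rewrite (le_trans (ler_normB _ _))// lerD2r.
rewrite integral_cst// [X in (_ * X)%E](_ : _ = 1%E) ?mule1 ?ltry//.
exact: probability_setT.
Qed.

(** On the support of the truncation [x - t] is bounded by [M + t], so
    [2 cosh (l (x - t)) - 2] is of order [l ^ 2] uniformly in [x]. *)
Lemma tmgf_second_difference M t d l : 0 <= t -> 0 <= l ->
  l * (M%:R + t) <= 1 / 2 ->
  tmgf mu M t (d + l) + tmgf mu M t (d - l) <=
  (2 + 4 * (l * (M%:R + t)) ^+ 2) * tmgf mu M t d.
Proof.
move=> t0 l0 lM; set c := 2 + _.
have c0 : 0 <= c by rewrite addr_ge0// mulr_ge0// sqr_ge0.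
rewrite -lee_fin EFinD EFinM -!tmgfE -ge0_integralZl//; last 2 first.
- exact: measurable_EFin_tilt.
- by move=> x _; rewrite lee_fin tilt_ge0.
rewrite -ge0_integralD//; last 4 first.
- by move=> x _; rewrite lee_fin tilt_ge0.
- exact: measurable_EFin_tilt.
- by move=> x _; rewrite lee_fin tilt_ge0.
- exact: measurable_EFin_tilt.
apply: ge0_le_integral => //.
- by move=> x _; rewrite -EFinD lee_fin addr_ge0// tilt_ge0.
- by apply: emeasurable_funD; exact: measurable_EFin_tilt.
- by apply: measurable_funeM; exact: measurable_EFin_tilt.
move=> x _; rewrite -EFinD -EFinM lee_fin /tilt mulrA -mulrDl.
case: (tilt_case M t d x) => -[]; rewrite /tilt indicE mem_setE in_itv /= -ler_norml.
  move=> xM _; rewrite xM !mulr1.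
  have -> : (d + l) * (x - t) = d * (x - t) + l * (x - t) by ring.
  have -> : (d - l) * (x - t) = d * (x - t) + - (l * (x - t)) by ring.
  rewrite !expRD -mulrDr mulrC ler_wpM2r ?expR_ge0//.
  have lxM : `|l * (x - t)| <= l * (M%:R + t).
    rewrite normrM ger0_norm// ler_wpM2l// (le_trans (ler_normB _ _))//.
    by rewrite [`|t|]ger0_norm// lerD2r.
  apply: le_trans (expR_cosh_le (le_trans lxM lM)) _.
  rewrite lerD2l ler_pM2l// -real_normK ?num_real// lerXn2r ?nnegrE//.
  by rewrite mulr_ge0// addr_ge0.
by move=> /negP/negbTE -> _; rewrite !mulr0.
Qed.

Lemma tmgf_shift M t d : tmgf mu M t d = expR (- (d * t)) * tmgf mu M 0 d.
Proof.
apply: EFin_inj; rewrite EFinM -!tmgfE -ge0_integralZl//; last 2 first.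
- exact: measurable_EFin_tilt.
- by move=> x _; rewrite lee_fin tilt_ge0.
apply: eq_integral => x _; rewrite -EFinM /tilt mulrA -expRD.
by congr (expR _ * _)%:E; ring.
Qed.

Lemma tmgfN M d : symmetric_measure mu -> tmgf mu M 0 (- d) = tmgf mu M 0 d.
Proof.
move=> sym; rewrite /tmgf -[in LHS](symmetric_ge0_integral sym).
- congr fine; apply: eq_integral => x _; congr EFin.
  rewrite /tilt !indicE !mem_setE !in_itv /= -!ler_norml normrN.
  by congr (expR _ * _); ring.
- exact: measurable_EFin_tilt.
- by move=> x; rewrite lee_fin tilt_ge0.
Qed.

(** By symmetry [2 * tmgf mu M 0 d] is the integral of [2 cosh (d x)], which
    increases with [d >= 0]. *)
Lemma tmgf_mono M d d' : symmetric_measure mu -> 0 <= d -> d <= d' ->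
  tmgf mu M 0 d <= tmgf mu M 0 d'.
Proof.
move=> sym d0 dd'; rewrite -(ler_pMn2r (n := 2))// !mulr2n.
rewrite -{2}(tmgfN M d sym) -{2}(tmgfN M d' sym).
rewrite -lee_fin !EFinD -!tmgfE -!ge0_integralD//; last 8 first.
- by move=> x _; rewrite lee_fin tilt_ge0.
- exact: measurable_EFin_tilt.
- by move=> x _; rewrite lee_fin tilt_ge0.
- exact: measurable_EFin_tilt.
- by move=> x _; rewrite lee_fin tilt_ge0.
- exact: measurable_EFin_tilt.
- by move=> x _; rewrite lee_fin tilt_ge0.
- exact: measurable_EFin_tilt.
apply: ge0_le_integral => //.
- by move=> x _; rewrite -EFinD lee_fin addr_ge0// tilt_ge0.
- by apply: emeasurable_funD; exact: measurable_EFin_tilt.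
- by apply: emeasurable_funD; exact: measurable_EFin_tilt.
move=> x _; rewrite -!EFinD lee_fin /tilt -!mulrDl ler_wpM2r//.
rewrite !mulNr subr0; apply: expR_cosh_mono.
by rewrite !normrM ler_wpM2r// !ger0_norm// (le_trans d0).
Qed.

Lemma tmgf_le_mgf M d : ((tmgf mu M 0 d)%:E <= mgf mu d)%E.
Proof.
rewrite -tmgfE mgfE; apply: ge0_le_integral => //.
- by move=> x _; rewrite lee_fin tilt_ge0.
- exact: measurable_EFin_tilt.
- apply/measurable_EFinP/measurableT_comp => //; exact: measurable_funM.
- move=> x _; rewrite lee_fin; case: (tilt_case M 0 d x) => -[_ ->].
    by rewrite subr0.
  exact: expR_ge0.
Qed.

(** Monotone convergence; it also applies when [mgf mu d] is infinite. *)
Lemma tmgf_eventually_gt d (a : R) : (a%:E < mgf mu d)%E ->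
  exists M0, forall M, (M0 <= M)%N -> a < tmgf mu M 0 d.
Proof.
move=> amgf; pose F (i : nat) : set R := `[- i%:R, i%:R]%classic.
have mexp (D : set R) : measurable_fun D (fun x => (expR (d * x))%:E).
  by apply/measurable_EFinP/measurableT_comp => //; exact: measurable_funM.
have FE i : (\int[mu]_(x in F i) (expR (d * x))%:E = (tmgf mu i 0 d)%:E)%E.
  rewrite integral_mkcond -tmgfE; apply: eq_integral => x _.
  rewrite /patch /tilt indicE subr0.
  by case: (x \in F i); rewrite ?mulr1 ?mulr0.
have : ((tmgf mu i 0 d)%:E @[i --> \oo] --> mgf mu d)%E.
  rewrite (_ : mgf mu d = \int[mu]_(x in \bigcup_i F i) (expR (d * x))%:E)%E.
    rewrite (_ : (fun i => _) = fun i => \int[mu]_(x in F i) (expR (d * x))%:E)%E.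
      apply: ge0_nondecreasing_set_cvg_integral => //.
      - move=> m n mn; apply/subsetPset => x; rewrite /F /= !in_itv /= -!ler_norml.
        by move=> /le_trans; apply; rewrite ler_nat.
      - by move=> i; exact: measurable_itv.
    by apply/funext => i.
  rewrite mgfE; congr integral; apply/esym/seteqP; split => // x _.
  exists (Num.trunc `|x|).+1 => //; rewrite /F /= in_itv /= -ler_norml.
  exact/ltW/truncnS_gt.
move=> H; have [M0 _ H0] : \forall i \near \oo, (a%:E < (tmgf mu i 0 d)%:E)%E.
  apply: (H [set y | (a%:E < y)%E]); apply: open_nbhs_nbhs; split => //.
  exact: open_ereal_gt_ereal.
by exists M0 => M MM; rewrite -lte_fin; exact: H0.
Qed.

(** Some compact interval strictly to the right of [t] has positive mass [c];
    with [a] its distance to [t], the integrand is at least [exp (d * a)]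
    there. *)
Lemma tmgf_growth t : 0 < t -> (mu `]-oo, t]%classic < 1)%E ->
  exists c a : R, exists M0 : nat, [/\ 0 < c, 0 < a &
    forall M d, (M0 <= M)%N -> 0 <= d -> c * expR (d * a) <= tmgf mu M t d].
Proof.
move=> t0 Ft; pose F (i : nat) : set R := `[t + i.+1%:R^-1, i%:R]%classic.
have [n Fn] : exists n, (0 < mu (F n))%E.
  apply: contrapT => /forallNP F0.
  have : mu.-negligible (\bigcup_i F i).
    apply: negligible_bigcup => i; apply/negligibleP; first exact: measurable_itv.
    by apply/eqP; rewrite eq_le measure_ge0 andbT leNgt; apply/negP/F0.
  have sub : ~` `]-oo, t]%classic `<=` \bigcup_i F i.
    move=> x /= /negP; rewrite in_itv /= -ltNge => tx.
    exists (Num.trunc (x - t)^-1 + (Num.trunc x).+1)%N => //; rewrite /F /= in_itv /=.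
    apply/andP; split; last first.
      apply/ltW/(lt_le_trans (truncnS_gt x)); by rewrite ler_nat leq_addl.
    rewrite -lerBrDl -[leRHS]invrK lef_pV2 ?posrE ?invr_gt0 ?subr_gt0//.
    apply/ltW/(lt_le_trans (truncnS_gt _)).
    by rewrite ler_nat ltnS leq_addr.
  have mt : measurable `]-oo, t]%classic by exact: measurable_itv.
  move=> /(negligibleS sub) /(negligibleP _ (measurableC mt)) mu0.
  move: Ft; by rewrite -sube_gt0 -(probability_setC mu mt) mu0 ltxx.
exists (fine (mu (F n))), n.+1%:R^-1, n.
have Ffin : mu (F n) \is a fin_num by apply: fin_num_measure; exact: measurable_itv.
split => // [|M d nM d0]; first by rewrite fine_gt0// Fn ltey_eq Ffin.
rewrite -lee_fin -tmgfE mulrC EFinM fineK//.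
have -> : (mu (F n) = \int[mu]_x (\1_(F n) x : R)%:E)%E.
  by rewrite integral_indic ?setIT//; exact: measurable_itv.
have mI : measurable_fun setT (fun x => (\1_(F n) x : R)%:E).
  by apply/measurable_EFinP/measurable_indic; exact: measurable_itv.
rewrite -ge0_integralZl//.
apply: ge0_le_integral => //.
- by apply: measurable_funeM.
- exact: measurable_EFin_tilt.
move=> x _; rewrite -EFinM lee_fin indicE; case: (boolP (x \in F n)) => [|_].
  rewrite mulr1 in_setE /F /= in_itv /= => /andP[tx xn].
  case: (tilt_case M t d x) => -[xM ->].
    by rewrite ler_expR ler_wpM2l// lerBrDl.
  exfalso; apply: xM; rewrite ger0_norm; first by rewrite (le_trans xn)// ler_nat.
  by apply: le_trans tx; rewrite addr_ge0// ltW.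
by rewrite mulr0 tilt_ge0.
Qed.

End truncation.

(** * Balanced tilts and the tilted Chernoff bound *)

(** The truncation level must be uniform in [d].  Beyond [D] the growth bound
    suffices.  On [[0, D]] only finitely many points [j * eta] are checked, by
    monotone convergence; monotonicity of [tmgf mu M 0] carries the bound from
    [j * eta] to the next grid point, at the cost of the factor
    [exp (- eta * t) = exp (- e / 2)]. *)
Lemma truncated_mgf_ge (R : realType) (mu : probability R R) (t h e : R) :
  symmetric_measure mu -> 0 < t -> (mu `]-oo, t]%classic < 1)%E ->
  0 <= h -> 0 < e ->
  (forall d, 0 <= d -> ((expR (d * t - h))%:E <= mgf mu d)%E) ->
  exists (M : nat) (D : R), [/\ 0 <= D,
    forall d, 0 <= d -> expR (- h - e) <= tmgf mu M t d &
    forall d, D <= d -> 2 <= tmgf mu M t d].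
Proof.
move=> sym t0 Ft h0 e0 hmgf.
have [c [a [M1 [c0 a0 growth]]]] := tmgf_growth t0 Ft.
(* [D] solves [c * (D * a) = 2]. *)
pose D : R := 2 / (c * a); pose eta : R := e / 2 / t.
have D0 : 0 <= D by rewrite divr_ge0// mulr_ge0// ltW.
have eta0 : 0 < eta by rewrite !divr_gt0.
have etat : eta * t = e / 2 by rewrite /eta -mulrA mulVf ?mulr1// gt_eqF.
have grid N : exists M0, forall M j, (M0 <= M)%N -> (j <= N)%N ->
    expR (j%:R * eta * t - h - e / 2) <= tmgf mu M 0 (j%:R * eta).
  have pt (j : nat) : exists M0, forall M, (M0 <= M)%N ->
      expR (j%:R * eta * t - h - e / 2) <= tmgf mu M 0 (j%:R * eta).
    have jeta0 : 0 <= j%:R * eta by rewrite mulr_ge0// ltW.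
    have [|M0 HM] := @tmgf_eventually_gt _ mu (j%:R * eta)
        (expR (j%:R * eta * t - h - e / 2)).
      apply: lt_le_trans (hmgf _ jeta0).
      by rewrite lte_fin ltr_expR gtrDl oppr_lt0 divr_gt0.
    by exists M0 => M /HM /ltW.
  elim: N => [|N [M0 IH]].
    by have [M0 H] := pt 0%N; exists M0 => M [|j]// /H.
  have [M2 H] := pt N.+1; exists (maxn M0 M2) => M j.
  rewrite geq_max => /andP[MM0 MM2]; rewrite leq_eqVlt => /predU1P[->|].
    exact: H.
  exact: IH.
have [M2 HM2] := grid (Num.trunc (D / eta)).
have large M d : (M1 <= M)%N -> D <= d -> 2 <= tmgf mu M t d.
  move=> MM Dd; have d0 : 0 <= d by exact: le_trans Dd.
  apply: le_trans (growth M d MM d0).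
  apply: (@le_trans _ _ (c * (D * a))).
    by rewrite /D le_eqVlt; apply/orP; left; apply/eqP; field; rewrite !gt_eqF.
  rewrite (ler_wpM2l (ltW c0))//.
  apply: (@le_trans _ _ (d * a)); first by rewrite ler_wpM2r// ltW.
  by apply: le_trans (expR_ge1Dx _); rewrite lerDr.
exists (maxn M1 M2), D; split => // d; last by apply: large; rewrite leq_maxl.
move=> d0; have [Dd|dD] := leP D d.
  apply: (@le_trans _ _ 1); first by rewrite -expR0 ler_expR; lra.
  by apply: (@le_trans _ _ 2); [lra | apply: large => //; rewrite leq_maxl].
set M := maxn M1 M2; set j := Num.trunc (d / eta).
have de0 : 0 <= d / eta by rewrite divr_ge0// ltW.
have jd : j%:R * eta <= d by rewrite -ler_pdivlMr// truncn_le.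
have dj : d <= (j%:R + 1) * eta.
  by rewrite -ler_pdivrMr// natr1 ltW// truncnS_gt.
have jN : (j <= Num.trunc (D / eta))%N.
  by apply: le_truncn; rewrite ler_wpM2r// ?invr_ge0 ltW.
rewrite tmgf_shift.
apply: (@le_trans _ _ (expR (- (d * t)) * expR (j%:R * eta * t - h - e / 2))).
  rewrite -expRD ler_expR.
  have : d * t <= (j%:R + 1) * eta * t by rewrite ler_wpM2r// ltW.
  by rewrite -mulrA etat mulrDl mul1r -etat mulrA; lra.
rewrite ler_wpM2l ?expR_ge0//; apply: le_trans (HM2 M j _ jN) _.
  by rewrite leq_maxr.
by apply: tmgf_mono => //; rewrite mulr_ge0// ltW.
Qed.

Lemma approx_minimiser (R : realType) (g : R -> R) (b z : R) :
  0 < b -> (forall d, 0 <= d -> b <= g d) -> 0 < z ->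
  exists2 d, 0 <= d & forall d', 0 <= d' -> g d <= (1 + z) * g d'.
Proof.
move=> b0 bg z0; pose S := [set g d | d in [set d | 0 <= d]].
have lbS : lbound S b by move=> _ [d /= d0 <-]; exact: bg.
have S0 : S !=set0 by exists (g 0), 0 => /=.
have hinf : has_inf S by split => //; exists b.
have bI : b <= inf S by exact: lb_le_inf.
have I0 : 0 < inf S by exact: lt_le_trans bI.
have [_ [d /= d0 <-] dI] := inf_adherent (mulr_gt0 z0 I0) hinf.
exists d => // d' d'0; apply: (le_trans (ltW dI)).
rewrite -[X in X + _]mul1r -mulrDl ler_wpM2l//; first by rewrite addr_ge0// ltW.
by apply: inf_lbound; [case: hinf | exists d'].
Qed.

(** Let [G = tmgf mu M t] and let [d] minimise [G] up to the factor
    [1 + l ^ 2].  Then [G (d - l) >= (1 - l ^ 2) * G d], so the second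
    difference bound leaves [G (d + l) <= (1 + C * l ^ 2) * G d], and
    symmetrically for [d - l].  For small [l] the quadratic term is below
    [l * th / 2].  The second hypothesis on [G] keeps [d] below [D], because
    [G 0 <= 1]. *)
Lemma balanced_tilt (R : realType) (mu : probability R R) M (t th b D : R) :
  symmetric_measure mu -> 0 <= t -> 0 < th -> 0 < b ->
  (forall d, 0 <= d -> b <= tmgf mu M t d) ->
  (forall d, D <= d -> 2 <= tmgf mu M t d) ->
  exists d l, [/\ 0 <= d <= D, 0 < l,
    tmgf mu M t (d + l) <= tmgf mu M t d * expR (l * th / 2) &
    tmgf mu M t (d - l) <= tmgf mu M t d * expR (l * th / 2)].
Proof.
move=> sym t0 th0 b0 bG G2; set G := tmgf mu M t.
pose A : R := M%:R + t; have A0 : 0 <= A by rewrite addr_ge0.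
(* The second difference contributes [4 * A ^+ 2] to the constant, the near
   minimality of [d] contributes [1]. *)
pose C : R := 4 * A ^+ 2 + 1.
have C0 : 0 < C by rewrite ltr_wpDl// mulr_ge0// sqr_ge0.
pose l := Num.min (th / (2 * C)) (1 / (2 * (A + 1))).
have l0 : 0 < l by rewrite lt_min !divr_gt0// ?mulr_gt0// ltr_wpDl.
have lC : l * C <= th / 2.
  apply: (@le_trans _ _ (th / (2 * C) * C)).
    by rewrite (ler_wpM2r (ltW C0))// ge_min lexx.
  by rewrite le_eqVlt; apply/orP; left; apply/eqP; field; rewrite gt_eqF.
have lA : l * (A + 1) <= 1 / 2.
  apply: (@le_trans _ _ (1 / (2 * (A + 1)) * (A + 1))).
    by rewrite ler_wpM2r ?addr_ge0// ge_min lexx orbT.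
  by rewrite le_eqVlt; apply/orP; left; apply/eqP; field; rewrite gt_eqF// ltr_wpDl.
have lA' : l * A <= 1 / 2 by apply: le_trans lA; rewrite ler_wpM2l ?lerDl// ltW.
have l12 : l <= 1 / 2.
  by apply: le_trans lA; rewrite mulrDr mulr1 lerDr mulr_ge0// ltW.
have [d d0 dmin] := approx_minimiser b0 bG (exprn_gt0 2 l0).
(* Minimality over [d >= 0] is minimality over the whole line, which matters
   since [d - l] may be negative. *)
have GN s : 0 <= s -> G s <= G (- s).
  move=> s0; rewrite /G tmgf_shift [leRHS]tmgf_shift tmgfN// ler_wpM2r//.
    by rewrite -lee_fin -tmgfE; apply: integral_ge0 => x _; rewrite lee_fin tilt_ge0.
  by rewrite ler_expR; nra.
have dminR s : G d <= (1 + l ^+ 2) * G s.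
  have [s0|s0] := leP 0 s; first exact: dmin.
  apply: le_trans (dmin (- s) _) _; first by rewrite oppr_ge0 ltW.
  rewrite ler_wpM2l ?addr_ge0 ?sqr_ge0//.
  by rewrite -[in leRHS](opprK s) GN// oppr_ge0 ltW.
have Gd0 : 0 < G d by exact: lt_le_trans (bG _ d0).
have low s : (1 - l ^+ 2) * G d <= G s.
  have l20 : 0 <= l ^+ 2 by exact: sqr_ge0.
  have l21 : 0 <= 1 - l ^+ 2 by nra.
  have Gs0 : 0 < G s.
    by have := lt_le_trans Gd0 (dminR s); rewrite pmulr_rgt0// ltr_wpDr.
  apply: le_trans (ler_wpM2l l21 (dminR s)) _.
  rewrite mulrA; move: (l ^+ 2) l20 => q q0; nra.
have second := tmgf_second_difference mu d t0 (ltW l0) lA'.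
have up s s' : G s + G s' <= (2 + 4 * (l * A) ^+ 2) * G d ->
    G s <= G d * expR (l * th / 2).
  move=> ss; apply: (@le_trans _ _ (G d * (1 + l * th / 2))); last first.
    by rewrite ler_wpM2l ?expR_ge1Dx// ltW.
  have lows := low s'.
  apply: (@le_trans _ _ ((1 + l * (l * C)) * G d)).
    by rewrite /C; move: lows ss; rewrite exprMn; nra.
  rewrite mulrC ler_wpM2l// ?(ltW Gd0)// lerD2l -mulrA ler_wpM2l//; exact: ltW.
exists d, l; split => //.
- rewrite d0 leNgt; apply/negP => /ltW /G2.
  have G01 : G 0 <= 1.
    rewrite /G tmgf_shift mul0r oppr0 expR0 mul1r -lee_fin.
    apply: le_trans (tmgf_le_mgf _ _ _) _; rewrite mgfE.
    under eq_integral do rewrite mul0r expR0.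
    by rewrite integral_cst// mul1e; exact: probability_le1.
  have := dminR 0; rewrite -/G; nra.
- exact: up second.
- by apply: up; rewrite addrC; exact: second.
Qed.

Lemma prod_tilt (R : realType) M (t d : R) k (w : k.-tuple R) :
  \prod_i tilt M t d (tnth w i) =
  expR (d * (\sum_i tnth w i - k%:R * t)) *
  \prod_i \1_(`[- M%:R, M%:R]%classic) (tnth w i).
Proof.
rewrite big_split /= -expR_sum -mulr_sumr sumrB sumr_const card_ord.
by rewrite mulr_natl.
Qed.

(** Let [Y] be the centered sum.  If [Y > k * th] then
    [exp (d * Y) <= exp (- l * k * th) * exp ((d + l) * Y)], if [Y < - k * th]
    the same holds with [d - l], and otherwise the event on the right-hand side
    occurs and [exp (d * Y) <= exp (d * k * th)]. *)
Lemma tilted_chernoff (R : realType) (mu : probability R R) M (t th d l : R) k :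
  0 <= d -> 0 <= l ->
  ((tmgf mu M t d ^+ k)%:E <=
   (expR (d * (k%:R * th)))%:E *
     iid_law mu k [set w | (k%:R * (t - th) <= \sum_i tnth w i)%R] +
   (expR (- l * (k%:R * th)) *
     (tmgf mu M t (d + l) ^+ k + tmgf mu M t (d - l) ^+ k))%:E)%E.
Proof.
move=> d0 l0; set A := [set w | _].
have mA : measurable A by exact: measurable_sum_ge.
have powE s : (\int[iid_law mu k]_w (\prod_i tilt M t s (tnth w i))%:E =
    (tmgf mu M t s ^+ k)%:E)%E.
  rewrite (ge0_integral_iid_prod mu (f := fun=> tilt M t s)).
  - by rewrite tmgfE prodEFin prodr_const card_ord.
  - by move=> _; exact: measurable_tilt.
  - by move=> _; exact: tilt_ge0.
have mprod s : measurable_fun setT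
    (fun w : k.-tuple R => (\prod_i tilt M t s (tnth w i))%:E).
  apply/measurable_EFinP; apply: measurable_prod => i _.
  by apply: measurableT_comp; [exact: measurable_tilt | exact: measurable_tnth].
have prod0 s (w : k.-tuple R) : 0 <= \prod_i tilt M t s (tnth w i).
  by apply: prodr_ge0 => i _; exact: tilt_ge0.
have mI : measurable_fun setT (fun w : k.-tuple R => (\1_A w : R)%:E).
  by apply/measurable_EFinP; exact: measurable_indic.
have -> : iid_law mu k A = (\int[iid_law mu k]_w (\1_A w)%:E)%E.
  by rewrite integral_indic ?setIT.
rewrite EFinM EFinD -!powE -ge0_integralD//; last 2 first.
- by move=> w _; rewrite lee_fin.
- by move=> w _; rewrite lee_fin.
rewrite -!ge0_integralZl//; last 2 first.
- exact: emeasurable_funD.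
- by move=> w _; rewrite -EFinD lee_fin addr_ge0.
rewrite -ge0_integralD//; last 3 first.
- exact: measurable_funeM.
- by move=> w _; rewrite -EFinD -EFinM lee_fin mulr_ge0 ?expR_ge0// addr_ge0.
- by apply: measurable_funeM; exact: emeasurable_funD.
apply: ge0_le_integral => //.
- by move=> w _; rewrite lee_fin.
- apply: emeasurable_funD; first exact: measurable_funeM.
  by apply: measurable_funeM; exact: emeasurable_funD.
move=> w _; rewrite -!(EFinM, EFinD) lee_fin !prod_tilt -mulrDl.
set I := \prod_i _; set Y := _ - _.
have I0 : 0 <= I by apply: prodr_ge0 => i _; rewrite indicE ler0n.
have I1 : I <= 1.
  by apply: prodr_ile1 => i _; rewrite indicE ler0n lern1 leq_b1.
set c := expR (- l * _).
have c0 : 0 <= c by exact: expR_ge0.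
apply: (@le_trans _ _ ((expR (d * (k%:R * th)) * \1_A w +
    c * (expR ((d + l) * Y) + expR ((d - l) * Y))) * I)); last first.
  by rewrite [leLHS]mulrDl -[X in _ + X <= _]mulrA lerD2r ler_piMr// mulr_ge0
    ?expR_ge0// indicE ler0n.
rewrite ler_wpM2r//.
have A0 : 0 <= expR (d * (k%:R * th)) * \1_A w.
  by rewrite mulr_ge0 ?expR_ge0// indicE ler0n.
have [Yk|kY] := leP Y (k%:R * th); last first.
  rewrite -[leLHS]add0r lerD// [leRHS]mulrDr -[leLHS]addr0 lerD//;
    last by rewrite mulr_ge0 ?expR_ge0.
  by rewrite -expRD ler_expR; nra.
have [kY|Yk'] := leP (- (k%:R * th)) Y; last first.
  rewrite -[leLHS]add0r lerD// [leRHS]mulrDr -[leLHS]add0r lerD//;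
    first by rewrite mulr_ge0 ?expR_ge0.
  by rewrite -expRD ler_expR; nra.
rewrite indicE mem_set; last by rewrite /A /=; move: kY; rewrite /Y; lra.
rewrite mulr1 -[leLHS]addr0 lerD//; first by rewrite ler_expR ler_wpM2l.
by rewrite mulr_ge0// addr_ge0// expR_ge0.
Qed.

(** * Cramer's lower bound and near-optimal families *)

(** The balanced tilt makes the two Chernoff terms at most
    [G ^+ k * exp (- k * l * th / 2)] each, so half of [G ^+ k] is left for the
    event once [k] is large.  The loss [exp (d * k * th)] is harmless because
    [th] may be decreased once the bound [d <= D] is known. *)
Lemma cramer_lower (R : realType) (mu : probability R R) (t h e th : R) :
  symmetric_measure mu -> 0 < t -> (mu `]-oo, t]%classic < 1)%E ->
  0 <= h -> 0 < e -> 0 < th ->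
  (forall d, 0 <= d -> ((expR (d * t - h))%:E <= mgf mu d)%E) ->
  exists K, forall k, (K <= k)%N ->
    ((expR (- (k%:R * (h + e))))%:E <=
     iid_law mu k [set w | (k%:R * (t - th) <= \sum_i tnth w i)%R])%E.
Proof.
move=> sym t0 Ft h0 e0 th0 hmgf.
have e30 : 0 < e / 3 by rewrite divr_gt0.
have [M [D [D0 Gge G2]]] := truncated_mgf_ge sym t0 Ft h0 e30 hmgf.
(* The budget [e] is split in three: truncation, the loss [d * th'], and the
   factor [1 / 2]. *)
pose th' := Num.min th (e / 3 / (D + 1)).
have D10 : 0 < D + 1 by rewrite ltr_wpDl.
have th'0 : 0 < th' by rewrite lt_min th0 divr_gt0.
have th'D : D * th' <= e / 3.
  apply: (@le_trans _ _ ((D + 1) * (e / 3 / (D + 1)))); last first.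
    by rewrite mulrCA mulfV ?gt_eqF// mulr1.
  by apply: ler_pM => //; rewrite ?lerDl ?ge_min ?lexx ?orbT// ltW.
have [d [l [/andP[d0 dD] l0 Gup Gdown]]] :=
  balanced_tilt sym (ltW t0) th'0 (expR_gt0 _) Gge G2.
have lth0 : 0 < l * th' by rewrite mulr_gt0.
exists (Num.trunc (6 / (l * th') + 3 / e)).+1 => k Kk.
have kK : 6 / (l * th') + 3 / e <= k%:R.
  by apply/ltW/(lt_le_trans (truncnS_gt _)); rewrite ler_nat.
have k0 : 0 <= k%:R :> R by [].
have k1 : 6 <= k%:R * (l * th').
  rewrite -ler_pdivrMr//; apply: le_trans kK.
  by rewrite lerDl divr_ge0// ltW.
have k2 : 3 <= k%:R * e.
  rewrite -ler_pdivrMr//; apply: le_trans kK.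
  by rewrite lerDr divr_ge0// ltW.
move: (tmgf mu M t d) (Gge d d0) Gup Gdown (tilted_chernoff mu M t th' k d0 (ltW l0)).
set P := iid_law _ _ _ => G Glow Gup Gdown Gk.
have Pfin : P \is a fin_num.
  by apply: fin_num_measure; exact: measurable_sum_ge.
apply: (@le_trans _ _ P); last first.
  apply: le_measure; rewrite ?inE; [exact: measurable_sum_ge..|].
  move=> w /=; apply: le_trans; rewrite ler_wpM2l// lerD2l lerN2.
  by rewrite ge_min lexx.
have G0 : 0 < G by exact: lt_le_trans (expR_gt0 _) Glow.
pose E := expR (- (k%:R * (l * th') / 2)).
have E4 : E <= 1 / 4.
  have := expR_ge1Dx (k%:R * (l * th') / 2).
  have := expRxMexpNx_1 (k%:R * (l * th') / 2).
  have := expR_gt0 (k%:R * (l * th') / 2).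
  by rewrite -/E; nra.
have tail s : 0 <= tmgf mu M t s -> tmgf mu M t s <= G * expR (l * th' / 2) ->
    expR (- l * (k%:R * th')) * tmgf mu M t s ^+ k <= G ^+ k * E.
  move=> s0 sG.
  apply: (@le_trans _ _ (expR (- l * (k%:R * th')) * (G * expR (l * th' / 2)) ^+ k)).
    by rewrite ler_wpM2l ?expR_ge0// lerXn2r// nnegrE// (le_trans s0).
  rewrite exprMn -expRM_natl mulrCA ler_wpM2l ?exprn_ge0 ?(ltW G0)//.
  by rewrite -expRD /E ler_expR; lra.
have tmgf0 s : 0 <= tmgf mu M t s.
  rewrite -lee_fin -tmgfE; apply: integral_ge0 => x _.
  by rewrite lee_fin tilt_ge0.
have Gk0 : 0 < G ^+ k by rewrite exprn_gt0.
have half : G ^+ k / 2 <= expR (d * (k%:R * th')) * fine P.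
  move: Gk; rewrite -(fineK Pfin) -EFinM -EFinD lee_fin mulrDr.
  have := tail _ (tmgf0 (d + l)) Gup; have := tail _ (tmgf0 (d - l)) Gdown.
  by nra.
rewrite -(fineK Pfin) lee_fin -(ler_pM2l (expR_gt0 (d * (k%:R * th')))).
apply: le_trans half; rewrite -expRD.
apply: (@le_trans _ _ (expR (- h - e / 3) ^+ k * expR (- 1))).
  rewrite -expRM_natl -expRD ler_expR.
  have : d * th' <= e / 3 by apply: le_trans th'D; rewrite ler_wpM2r// ltW.
  by move=> dth; nra.
apply: ler_pM; rewrite ?exprn_ge0 ?expR_ge0//.
  by rewrite lerXn2r ?nnegrE ?expR_ge0// ltW.
have := expR_ge1Dx (1 : R); have := expRxMexpNx_1 (1 : R).
by have := expR_gt0 (- 1 : R); nra.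
Qed.

(** Positive mass [c] beyond [t] gives [L(d) >= c * exp (d * t)], hence a rate
    of at most [- ln c]; and [d = 0] shows that it is nonnegative. *)
Lemma rate_finite (R : realType) (mu : probability R R) (t : R) :
  0 < t -> (mu `]-oo, t]%classic < 1)%E ->
  exists h : R, [/\ 0 <= h, rate mu t = h%:E &
    forall d, 0 <= d -> ((expR (d * t - h))%:E <= mgf mu d)%E].
Proof.
move=> t0 Ft; have [c [a [M [c0 a0 growth]]]] := tmgf_growth t0 Ft.
have mgf_ge d : 0 <= d -> ((c * expR (d * t))%:E <= mgf mu d)%E.
  move=> d0; apply: le_trans (tmgf_le_mgf mu M d); rewrite lee_fin.
  have := growth M d (leqnn _) d0; rewrite tmgf_shift.
  move=> /(ler_wpM2l (expR_ge0 (d * t))).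
  rewrite [X in _ <= X -> _]mulrA expRxMexpNx_1 mul1r; apply: le_trans.
  rewrite mulrC ler_wpM2l ?expR_ge0// ler_peMr ?(ltW c0)//.
  by rewrite -expR0 ler_expR mulr_ge0// ltW.
have rate_ub : (rate mu t <= (- ln c)%:E)%E.
  apply: ge_ereal_sup => _ [d /= d0 <-]; have := mgf_ge d d0.
  case E : (mgf mu d) => [l| |] //; last by rewrite /= leNye.
  rewrite lee_fin => cl.
  have l0 : 0 < l by apply: lt_le_trans cl; rewrite mulr_gt0// expR_gt0.
  rewrite lne_EFin// -EFinB lee_fin.
  have := cl; rewrite -[X in _ <= X -> _]lnK// -[X in X * _]lnK// -expRD ler_expR.
  lra.
have mgf0 : mgf mu 0 = 1%E.
  rewrite mgfE; under eq_integral do rewrite mul0r expR0.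
  by rewrite integral_cst// mul1e; exact: probability_setT.
have rate_lb : (0 <= rate mu t)%E.
  apply: ereal_sup_ubound; exists 0 => //=.
  by rewrite mgf0 lne1 mul0r sube0.
have rfin : rate mu t \is a fin_num.
  by rewrite ge0_fin_numE// (le_lt_trans rate_ub)// ltry.
exists (fine (rate mu t)); split; rewrite ?fineK ?fine_ge0// => d d0.
have : ((d * t)%:E - lne (mgf mu d) <= (fine (rate mu t))%:E)%E.
  by rewrite fineK//; apply: ereal_sup_ubound; exists d.
have := mgf_ge d d0; case E : (mgf mu d) => [l| |] //; last by move=> _ _; rewrite leey.
rewrite !lee_fin => cl.
have l0 : 0 < l by apply: lt_le_trans cl; rewrite mulr_gt0// expR_gt0.
rewrite lne_EFin// -EFinB lee_fin => H.
by rewrite -[leRHS]lnK// ler_expR; lra.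
Qed.

(** The number of blocks is the integer part of [exp (k (h + eps))], which
    exceeds the inverse of the success probability [p] of one block by the
    factor [exp (k * eps / 2)]; so the probability that every attempt fails is
    at most [eps / 2].  Aiming at [t * (1 - eps / 2)] instead of [t] loses
    another such factor, and [(1 - eps / 2)^2 >= 1 - eps]. *)
Lemma near_optimal_family (R : realType) (mu : probability R R) (t h eps : R) :
  symmetric_measure mu -> mu.-integrable setT (EFin : R -> \bar R) ->
  0 < t -> (mu `]-oo, t]%classic < 1)%E -> 0 <= h ->
  (forall d, 0 <= d -> ((expR (d * t - h))%:E <= mgf mu d)%E) ->
  0 < eps < 1 ->
  exists (k n : nat) (X : {set {set 'I_n}}),
    [/\ (1 <= k)%N, (0 < #|X|)%N, (forall x, x \in X -> #|x| = k),
         (1 - eps) * t <= k%:R^-1 * Gamma X mu &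
         k%:R^-1 * ln #|X|%:R <= h + eps].
Proof.
move=> sym imu t0 Ft h0 hmgf /andP[eps0 eps1].
have e20 : 0 < eps / 2 by rewrite divr_gt0.
have th0 : 0 < t * (eps / 2) by rewrite mulr_gt0.
have [K HK] := cramer_lower sym t0 Ft h0 e20 th0 hmgf.
pose k := (K + (Num.trunc ((2 / eps + 1) * (2 / eps))).+1)%N.
have k0 : (0 < k)%N by rewrite /k addnS.
have kR : 0 < k%:R :> R by rewrite ltr0n.
have kbig : 2 / eps + 1 <= k%:R * (eps / 2).
  rewrite -ler_pdivrMr// invf_div; apply/ltW/(lt_le_trans (truncnS_gt _)).
  by rewrite ler_nat leq_addl.
have := HK k (leq_addr _ _); set p := expR _ => pP.
have p0 : 0 < p by exact: expR_gt0.
have p1 : p <= 1.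
  by rewrite -expR0 ler_expR oppr_le0 mulr_ge0// addr_ge0// ltW.
pose N := Num.trunc (expR (k%:R * (h + eps))).
have N1 : (1 <= N)%N.
  by rewrite truncn_gt0 -expR0 ler_expR mulr_ge0// addr_ge0// ltW.
have Nle : N%:R <= expR (k%:R * (h + eps)) by rewrite truncn_le expR_ge0.
have Ngt : expR (k%:R * (h + eps)) < N%:R + 1 by rewrite natr1 truncnS_gt.
pose m := N.-1; have mN : m.+1 = N by rewrite prednK.
have pm : 2 / eps <= p * m%:R.
  have : p * expR (k%:R * (h + eps)) = expR (k%:R * (eps / 2)).
    by rewrite -expRD; congr expR; lra.
  have := expR_ge1Dx (k%:R * (eps / 2)).
  have : m%:R + 1 = N%:R :> R by rewrite natr1 mN.
  by nra.
have s0 : 0 <= k%:R * (t - t * (eps / 2)).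
  by rewrite mulr_ge0// subr_ge0 ler_piMr ?(ltW t0)//; lra.
have [n [X [X0 Xm Xk XG]]] := family_Gamma_ge m sym imu s0 pP.
exists k, n, X; split => //.
  rewrite ler_pdivlMl//; apply: le_trans XG.
  have fail : (1 - p) ^+ m <= eps / 2.
    apply: (@le_trans _ _ (expR (- (p * m%:R)))).
      rewrite -mulNr mulrC expRM_natl lerXn2r ?nnegrE ?subr_ge0 ?expR_ge0//.
      exact: expR_ge1Dx.
    have pm1 : 1 <= (eps / 2) * expR (p * m%:R).
      apply: (@le_trans _ _ (eps / 2 * (2 / eps))).
        have -> : eps / 2 * (2 / eps) = 1 by field; rewrite gt_eqF.
        by [].
      rewrite (ler_wpM2l (ltW e20))//; apply: le_trans pm _.
      by apply: le_trans (expR_ge1Dx _); rewrite lerDr.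
    rewrite -(ler_pM2r (expR_gt0 (p * m%:R))) mulrC expRxMexpNx_1//.
  have kt0 : 0 < k%:R * t by rewrite mulr_gt0.
  apply: (@le_trans _ _ ((1 - eps / 2) * (k%:R * (t - t * (eps / 2))))).
    rewrite -subr_ge0.
    have -> : (1 - eps / 2) * (k%:R * (t - t * (eps / 2))) -
        k%:R * ((1 - eps) * t) = k%:R * t * (eps / 2) ^+ 2 by field.
    by rewrite mulr_ge0 ?sqr_ge0// ltW.
  by rewrite ler_wpM2r//; lra.
rewrite ler_pdivrMl//.
apply: (@le_trans _ _ (ln (expR (k%:R * (h + eps))))); last by rewrite expRK.
rewrite ler_ln ?posrE ?ltr0n ?expR_gt0//.
by apply: le_trans Nle; rewrite ler_nat -mN.
Qed.
Theorem theorem5p1 (R : realType) (mu : probability R R)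
    (mu_sym : symmetric_measure mu)
    (mgf_fin : \forall delta \near (0 : R), (mgf mu delta < +oo)%E) :
  (forall (k n : nat) (X : {set {set 'I_n}}),
      (1 <= k <= n)%N -> (0 < #|X|)%N -> (forall x, x \in X -> #|x| = k) ->
      (rate mu (k%:R^-1 * Gamma X mu) <= (k%:R^-1 * ln #|X|%:R)%:E)%E)
  /\
  (forall t : R, 0 < t -> (mu `]-oo, t]%classic < 1)%E ->
   forall eps : R, 0 < eps < 1 / 10 ->
   exists (k n : nat) (X : {set {set 'I_n}}),
     [/\ (1 <= k)%N,
         (0 < #|X|)%N,
         (forall x, x \in X -> #|x| = k),
         (1 - eps) * t <= k%:R^-1 * Gamma X mu &
         ((k%:R^-1 * ln #|X|%:R)%:E <= rate mu t + eps%:E)%E]).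
Proof.
have imu := mgf_fin_integrable mgf_fin; split.
  move=> k n X /andP[k0 _] X0 Xk; exact: rate_Gamma_le.
move=> t t0 Ft eps /andP[eps0 eps1].
have [h [h0 -> hmgf]] := rate_finite t0 Ft.
have [|k [n [X [k1 X0 Xk XG XN]]]] :=
  near_optimal_family (eps := eps) mu_sym imu t0 Ft h0 hmgf.
  by rewrite eps0 (lt_trans eps1)//; lra.
by exists k, n, X; split => //; rewrite -EFinD lee_fin.
Qed.
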